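(* Let $n\ge 1$ and let $\mathbf{L}$ be a De~Morgan lattice. The $n$-filters on $\mathbf{L}$ are precisely the intersections of non-empty families of prime $n$-filters on $\mathbf{L}$. Likewise, the complete (respectively consistent, classical, Kalman) $n$-filters on $\mathbf{L}$ are precisely the intersections of non-empty families of complete (respectively consistent, classical, Kalman) prime $n$-filters on $\mathbf{L}$.
   Context: A De~Morgan lattice is a distributive lattice (not necessarily bounded) with a unary operation $\neg$ satisfying $\neg\neg x=x$, $\neg(x\vee y)=\neg x\wedge\neg y$, $\neg(x\wedge y)=\neg x\vee\neg y$. An $n$-filter is an upset $F$ such that for every non-empty finite $Y\subseteq L$: if $\bigwedge X\in F$ for every non-empty $X\subseteq Y$ with $|X|\le n$, then $\bigwedge Y\in F$. An upset $F$ is prime if $x\vee y\in F$ implies $x\in F$ or $y\in F$ (the empty set counts as prime). An upset $F$ is almost complete if $x\in F$ implies $x\wedge(y\vee\neg y)\in F$ for all $x,y$; complete if almost complete and non-empty; almost consistent if $(x\wedge\neg x)\vee y\in F$ implies $y\in F$; consistent if almost consistent and $F\ne L$; classical if complete and consistent; Kalman if $((x\wedge\neg x)\wedge z)\vee u\in F$ implies $((y\vee\neg y)\wedge z)\vee u\in F$ for all $x,y,z,u$. *)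

(* Defs.v *)
From HB Require Import structures.
From mathcomp Require Import all_boot all_order.
From mathcomp Require Import finmap.
From mathcomp Require Import boolp classical_sets.

Set Implicit Arguments.
Unset Strict Implicit.
Unset Printing Implicit Defensive.

HB.mixin Record DistrLattice_isDeMorgan (d : Order.disp_t) L
    of Order.DistrLattice d L := {
  neg : L -> L;
  negK : forall x : L, neg (neg x) = x;
  negU : forall x y : L, neg (x `|` y)%O = (neg x `&` neg y)%O;
  negI : forall x y : L, neg (x `&` y)%O = (neg x `|` neg y)%O
}.

#[short(type="deMorganLatticeType")]
HB.structure Definition DeMorganLattice (d : Order.disp_t) :=
  { L of DistrLattice_isDeMorgan d L & Order.DistrLattice d L }.

Section Filters.
Context {d : Order.disp_t} {L : deMorganLatticeType d}.
Implicit Types F G : set L.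

Definition upset F := forall x y : L, F x -> (x <= y)%O -> F y.

(* [L] need not have a top, so the meet of a finite set takes a default [x0],
   which is the value on the empty set and is irrelevant elsewhere. On a
   non-empty set the big operator starts from a member of the set, which does
   not change the meet, by idempotence. *)
Definition fmeet (x0 : L) (X : {fset L}) : L :=
  \big[Order.meet/head x0 X]_(x <- X) x.

Definition nfilter (n : nat) F :=
  upset F /\
  forall (x0 : L) (Y : {fset L}), Y != fset0 ->
    (forall X : {fset L}, (X `<=` Y)%fset -> X != fset0 -> #|` X| <= n ->
       F (fmeet x0 X)) ->
    F (fmeet x0 Y).

Definition prime_upset F :=
  upset F /\ forall x y : L, F (x `|` y)%O -> F x \/ F y.

Definition almost_complete F :=
  upset F /\ forall x y : L, F x -> F (x `&` (y `|` neg y))%O.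

Definition complete_upset F := almost_complete F /\ (F !=set0)%classic.

Definition almost_consistent F :=
  upset F /\ forall x y : L, F ((x `&` neg x) `|` y)%O -> F y.

Definition consistent_upset F := almost_consistent F /\ F <> setT.

Definition classical_upset F := complete_upset F /\ consistent_upset F.

Definition kalman_upset F :=
  upset F /\
  forall x y z u : L,
    F (((x `&` neg x) `&` z) `|` u)%O -> F (((y `|` neg y) `&` z) `|` u)%O.

Definition prime_nfilter (n : nat) F := nfilter n F /\ prime_upset F.

Definition nonempty_intersection_of (P : set L -> Prop) F :=
  exists Fs : set (set L),
    [/\ (Fs !=set0)%classic,
        (forall G, Fs G -> P G)
      & F = (\bigcap_(G in Fs) G)%classic].

End Filters.

(* Main.v *)
(** Let [F] be an n-filter and [a] a point outside [F]. By Zorn's lemma there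
    is an ideal [I] containing [a] which is maximal among the ideals disjoint
    from [F]. Its complement is a prime upset which contains [F] and omits [a].
    By maximality each [z] outside [I] satisfies [F (z `|` i)] for some [i] in
    [I], whereas no [z] in [I] does. Each of the closure conditions on [F]
    (n-filter, almost complete, almost consistent, Kalman) survives joining all
    elements involved with a fixed [i], by distributivity, so it passes to the
    complement of [I]. *)
Require Import Defs.
From mathcomp Require Import all_boot all_order.
From mathcomp Require Import finmap.
From mathcomp Require Import boolp classical_sets.

Set Implicit Arguments.
Unset Strict Implicit.
Unset Printing Implicit Defensive.

Import Order.Theory.
Local Open Scope order_scope.

(** * Meets of finite non-empty sets *)

Section FiniteMeets.
Context {d : Order.disp_t} {L : deMorganLatticeType d}.
Implicit Types (x y z i : L) (X Y : {fset L}).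

Lemma fmeet_le x0 X x : x \in X -> fmeet x0 X <= x.
Proof.
rewrite /fmeet -[x \in X]/(x \in enum_fset X).
(* The default is generalised because the head belongs to the whole list and must stay fixed while
   the list shrinks. *)
elim: (enum_fset X) (head _ _) => [//|y s IHs] h.
rewrite big_cons in_cons => /predU1P[->|xs]; first exact: leIl.
by rewrite leIxr // IHs.
Qed.

Lemma big_meet_joinr (s : seq L) h i :
  (\big[Order.meet/h]_(x <- s) x) `|` i
  = \big[Order.meet/h `|` i]_(x <- s) (x `|` i).
Proof. by elim: s => [|x s IHs]; rewrite ?big_nil // !big_cons joinIl IHs. Qed.

Lemma head_in_fset x0 X : X != fset0 -> head x0 X \in X.
Proof.
case/fset0Pn=> x; rewrite -[x \in X]/(x \in enum_fset X).
rewrite -[head _ _ \in X]/(head x0 X \in enum_fset X).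
by case: (enum_fset X) => [//|y s] _; exact: mem_head.
Qed.

(** Non-emptiness makes the default of the big operator a member of [X], so it too lies above
    [z]. *)
Lemma fmeet_ge x0 X z :
  X != fset0 -> (forall x, x \in X -> z <= x) -> z <= fmeet x0 X.
Proof.
move=> X0 zX; rewrite /fmeet big_seq; elim/big_ind: _ => //.
- by apply: zX; apply: head_in_fset.
- by move=> x y zx zy; rewrite lexI zx.
Qed.

Lemma le_fmeet_joinr x0 X i z :
  X != fset0 -> (forall x, x \in X -> z <= x `|` i) -> z <= fmeet x0 X `|` i.
Proof.
move=> X0 zX; rewrite /fmeet big_meet_joinr big_seq; elim/big_ind: _ => //.
- by apply: zX; apply: head_in_fset.
- by move=> x y zx zy; rewrite lexI zx.
Qed.

End FiniteMeets.

(** * Separating a point from an upset by a maximal ideal *)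

Section Separation.
Context {d : Order.disp_t} {L : deMorganLatticeType d}.
Implicit Types (F G I : set L) (x y z a i : L).

Definition join_ideal I :=
  (forall x y, I y -> x <= y -> I x) /\ (forall x y, I x -> I y -> I (x `|` y)).

(** The last field is maximality unfolded: the ideal generated by [I] and [z] consists of the
    elements below a join of [z] with some [i] in [I], so it meets the upset [F] exactly when [F]
    contains such a join. *)
Record maximal_ideal_avoiding F a I : Prop := MaximalIdealAvoiding {
  avoiding_ideal : join_ideal I;
  avoiding_mem : I a;
  avoiding_disjoint : forall x, I x -> ~ F x;
  avoiding_maximal : forall z, ~ I z -> exists2 i, I i & F (z `|` i) }.

Lemma exists_maximal_ideal_avoiding F a :
  upset F -> ~ F a -> exists I, maximal_ideal_avoiding F a I.
Proof.
move=> upF Fa.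
(* Zorn_bigcup also asks for an upper bound of the empty chain, so the empty
   ideal has to be admitted. *)
pose P I := [/\ join_ideal I, forall x, I x -> ~ F x & forall x, I x -> I a].
have [Fs FsP Fstot|I [[[dI jI] IF Ia] Imax]] := @Zorn_bigcup L P.
  split.
  - split=> [x y [J FsJ Jy] xy|x y [J FsJ Jx] [K FsK Ky]].
      by exists J => //; have [[dJ _] _ _] := FsP _ FsJ; apply: dJ xy.
    have [JK|KJ] := Fstot _ _ FsJ FsK.
      have [[_ jK] _ _] := FsP _ FsK.
      by exists K => //; apply: jK => //; apply: JK.
    have [[_ jJ] _ _] := FsP _ FsJ.
    by exists J => //; apply: jJ => //; apply: KJ.
  - by move=> x [J FsJ Jx]; have [_ JF _] := FsP _ FsJ; apply: JF.
  - move=> x [J FsJ Jx]; have [_ _ Ja] := FsP _ FsJ.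
    by exists J => //; apply: Ja Jx.
(* Otherwise [I] is empty, and the principal ideal of [a], which misses [F], is strictly larger. *)
have {}Ia : I a.
  apply: contrapT => nIa; apply: (Imax [set x | x <= a]%classic).
    by split=> [x /Ia //|aI]; apply: nIa; apply: aI => /=.
  split=> [|x xa Fx|x _] /=; last exact: lexx.
    split=> [x y /= ya xy|x y /= xa ya]; first exact: le_trans ya.
    by rewrite leUx xa.
  by apply: Fa; apply: upF Fx xa.
exists I; split=> [|//|//|z nIz]; first by split.
apply: contrapT => nzF.
(* The ideal generated by [I] and [z] would avoid [F] and strictly extend [I]. *)
apply: (Imax [set w | exists2 i, I i & (w <= z `|` i)%O]%classic).
  split=> [x Ix|zI]; first by exists x => //; apply: leUr.
  by apply: nIz; apply: zI; exists a => //; apply: leUl.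
split.
- split=> [x y [i Ii yi] xy|x y [i Ii xi] [j Ij yj]].
    by exists i => //; apply: le_trans yi.
  exists (i `|` j); first exact: jI.
  by rewrite leUx (le_trans xi) ?(le_trans yj) // leU2 ?leUl ?leUr.
- by move=> w [i Ii wi] Fw; apply: nzF; exists i => //; apply: upF wi.
- by move=> _ _; exists a => //; apply: leUr.
Qed.

(** * Closure conditions passing to the complement of the ideal *)

Section Complement.
Context (F I : set L) (a : L).
Hypotheses (upF : upset F) (maxI : maximal_ideal_avoiding F a I).

Let G := (~` I)%classic.

Let not_I x i : I i -> F (x `|` i) -> G x.
Proof.
move=> Ii Fxi Ix; apply: (avoiding_disjoint maxI) Fxi.
by have [_] := avoiding_ideal maxI; apply.
Qed.

Lemma sub_compl_avoiding : (F `<=` G)%classic.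
Proof. by move=> x Fx /(avoiding_disjoint maxI). Qed.

Lemma upset_compl_avoiding : upset G.
Proof. by have [dI _] := avoiding_ideal maxI => x y Gx xy /dI/(_ xy). Qed.

Lemma prime_compl_avoiding : prime_upset G.
Proof.
split; first exact: upset_compl_avoiding.
have [_ jI] := avoiding_ideal maxI.
move=> x y Gxy; apply/not_andP => -[Ix Iy]; exact: Gxy (jI _ _ Ix Iy).
Qed.

(** Joining the witnesses of finitely many elements gives one that serves them all, since [F] is an
    upset. *)
Lemma avoiding_maximal_seq (s : seq L) :
  exists2 i, I i & forall z, z \in s -> G z -> F (z `|` i).
Proof.
have [_ jI] := avoiding_ideal maxI.
elim: s => [|z s [i Ii Fs]]; first by exists a => //; apply: avoiding_mem maxI.
have [Iz|Gz] := pselect (I z).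
  by exists i => // w; rewrite in_cons => /predU1P[->|/Fs].
have [j Ij Fj] := avoiding_maximal maxI Gz.
exists (i `|` j); first exact: jI.
move=> w; rewrite in_cons => /predU1P[-> _|ws /(Fs _ ws) Fwi].
  by apply: upF Fj _; rewrite leU2 ?leUr.
by apply: upF Fwi _; rewrite leU2 ?leUl.
Qed.

Lemma nfilter_compl_avoiding n : nfilter n F -> nfilter n G.
Proof.
move=> [_ nF]; split=> [|x0 Y Y0 GX]; first exact: upset_compl_avoiding.
(* One [i] works for the meets of all subsets of [Y] at once. The n-filter condition on [F] is then
   applied to the set [Y'] of joins with [i], whose meet is below the join of the meet of [Y] with
   [i]. *)
have [i Ii Fi] := avoiding_maximal_seq [seq fmeet x0 X | X <- fpowerset Y].
apply: (not_I Ii).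
pose Y' := [fset (y `|` i)%O | y in Y]%fset.
have [y0 y0Y] := fset0Pn _ Y0.
have Y'0 : Y' != fset0 by apply/fset0Pn; exists (y0 `|` i); apply: in_imfset.
apply: (upF (nF x0 Y' Y'0 _)); last first.
  apply: le_fmeet_joinr => // y yY; apply: fmeet_le; exact: in_imfset.
move=> X' X'Y' X'0 X'n.
(* Joining with [i] need not be injective; choosing one preimage per element keeps the size of [X]
   at most that of [X']. The value [y0] is a filler outside [Y']. *)
have /choice[g gP] x : exists y, x \in Y' -> y \in Y /\ x = y `|` i.
  have [/imfsetP[y /= yY ->]|xY'] := boolP (x \in Y'); first by exists y.
  by exists y0.
pose X := [fset g x | x in X']%fset.
have XY : (X `<=` Y)%fset.
  by apply/fsubsetP => _ /imfsetP[x /= /(fsubsetP X'Y')/gP[gY _] ->].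
have X0 : X != fset0.
  by case/fset0Pn: X'0 => x xX'; apply/fset0Pn; exists (g x); apply: in_imfset.
have Xn : (#|` X| <= n)%N by apply: leq_trans X'n; apply: leq_imfset_card.
apply: upF (Fi (fmeet x0 X) _ (GX _ XY X0 Xn)) _.
  by apply: map_f; rewrite fpowersetE.
apply: fmeet_ge => // x xX'.
have [_ ->] := gP x (fsubsetP X'Y' _ xX').
by rewrite leU2 //; apply: fmeet_le; apply: in_imfset.
Qed.

Lemma almost_complete_compl_avoiding : almost_complete F -> almost_complete G.
Proof.
move=> [_ cF]; split=> [|x y Gx]; first exact: upset_compl_avoiding.
have [i Ii Fi] := avoiding_maximal maxI Gx.
apply: (not_I Ii); apply: upF (cF _ y Fi) _.
by rewrite joinIl leI2 ?leUl.
Qed.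

Lemma complete_compl_avoiding : complete_upset F -> complete_upset G.
Proof.
move=> [cF [x Fx]]; split; first exact: almost_complete_compl_avoiding.
by exists x; apply: sub_compl_avoiding.
Qed.

(** By associativity [i] is absorbed into the free disjunct [y]; [G] is proper because it omits
    [a]. *)
Lemma consistent_compl_avoiding : consistent_upset F -> consistent_upset G.
Proof.
move=> [[_ cF] _]; split; last first.
  by move=> GT; have: G a by [rewrite GT]; apply; apply: avoiding_mem maxI.
split=> [|x y Gxy]; first exact: upset_compl_avoiding.
have [i Ii Fi] := avoiding_maximal maxI Gxy.
by apply: (not_I Ii); apply: (cF x); rewrite joinA.
Qed.

(** Here [i] is absorbed into the free disjunct [u]. *)
Lemma kalman_compl_avoiding : kalman_upset F -> kalman_upset G.
Proof.
move=> [_ kF]; split=> [|x y z u Gxy]; first exact: upset_compl_avoiding.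
have [i Ii Fi] := avoiding_maximal maxI Gxy.
by apply: (not_I Ii); rewrite -joinA; apply: (kF x); rewrite joinA.
Qed.

End Complement.

(** The predicate [Q] stands for the extra condition (none, complete, consistent, classical or
    Kalman), so that one separation argument covers every case. *)
Lemma prime_intersection n (Q : set L -> Prop) F :
  nfilter n F -> Q F ->
  (forall a I, maximal_ideal_avoiding F a I -> Q (~` I)%classic) ->
  nonempty_intersection_of (fun G => prime_nfilter n G /\ Q G) F.
Proof.
move=> nF QF QC; have [upF _] := nF.
exists [set G | (prime_nfilter n G /\ Q G) /\ (F `<=` G)%classic]%classic.
have sep a : ~ F a ->
    exists G, [/\ prime_nfilter n G /\ Q G, (F `<=` G)%classic & ~ G a].
  move=> /(exists_maximal_ideal_avoiding upF)[I maxI]; exists (~` I)%classic.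
  split; [split; [split|exact: QC maxI]|exact: sub_compl_avoiding maxI|].
  - exact: (nfilter_compl_avoiding upF maxI nF).
  - exact: prime_compl_avoiding maxI.
  - by apply; apply: avoiding_mem maxI.
split=> [|G []//|].
(* If [F] is the whole lattice, there is no point to separate, and the family is non-empty because
   [F] itself is trivially prime. *)
- have [FT|/existsNP[a /sep[G [GP FG _]]]] := pselect (forall x, F x).
    by exists F; split=> //; split=> //; split=> //; split=> // x y _; left.
  by exists G.
- apply/seteqP; split=> [x Fx G [_]|x Gx]; first exact.
  by apply: contrapT => /sep[G [GP FG]]; apply; apply: Gx.
Qed.

End Separation.

(** * Closure conditions passing to intersections *)

Section Intersections.
Context {d : Order.disp_t} {L : deMorganLatticeType d}.
Variable Fs : set (set L).
Let F := (\bigcap_(G in Fs) G)%classic.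

Lemma upset_bigcap : (forall G, Fs G -> upset G) -> upset F.
Proof. by move=> up x y Fx xy G FsG; apply: up xy => //; apply: Fx. Qed.

Lemma nfilter_bigcap n : (forall G, Fs G -> nfilter n G) -> nfilter n F.
Proof.
move=> nF; split=> [|x0 Y Y0 FX G FsG].
  by apply: upset_bigcap => G /nF[].
have [_] := nF G FsG; apply=> // X XY X0 Xn; exact: FX.
Qed.

Lemma complete_bigcap : (Fs !=set0)%classic ->
  (forall G, Fs G -> complete_upset G) -> complete_upset F.
Proof.
move=> [G0 FsG0] cF; split; first split.
- by apply: upset_bigcap => G /cF[[]].
- by move=> x y Fx G FsG; have [[_ cG] _] := cF G FsG; apply: cG; apply: Fx.
- (* Each complete upset contains all the elements [y `|` neg y]. *)
  have [_ [y _]] := cF G0 FsG0; exists (y `|` neg y) => G FsG.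
  have [[upG cG] [x Gx]] := cF G FsG.
  by apply: upG (cG x y Gx) _; apply: leIr.
Qed.

(** Properness is inherited from any single member of the family. *)
Lemma consistent_bigcap : (Fs !=set0)%classic ->
  (forall G, Fs G -> consistent_upset G) -> consistent_upset F.
Proof.
move=> [G0 FsG0] cF; split; first split.
- by apply: upset_bigcap => G /cF[[]].
- move=> x y Fxy G FsG; have [[_ cG] _] := cF G FsG.
  by apply: (cG x); apply: Fxy.
- move=> FT; have [_] := cF G0 FsG0; apply; apply/seteqP; split=> // x _.
  by have: F x by [rewrite FT]; apply.
Qed.

Lemma kalman_bigcap : (forall G, Fs G -> kalman_upset G) -> kalman_upset F.
Proof.
move=> kF; split=> [|x y z u Fx G FsG].
  by apply: upset_bigcap => G /kF[].
by have [_ kG] := kF G FsG; apply: (kG x); apply: Fx.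
Qed.

End Intersections.

Lemma nfilter_intersectionP (d : Order.disp_t) (L : deMorganLatticeType d) n
    (Q : set L -> Prop) :
  (forall (F I : set L) a,
     upset F -> maximal_ideal_avoiding F a I -> Q F -> Q (~` I)%classic) ->
  (forall Fs : set (set L), (Fs !=set0)%classic -> (forall G, Fs G -> Q G) ->
     Q (\bigcap_(G in Fs) G)%classic) ->
  forall F, nfilter n F /\ Q F <->
    nonempty_intersection_of (fun G => prime_nfilter n G /\ Q G) F.
Proof.
move=> QC QI F; split=> [[nF QF]|[Fs [Fs0 FsP ->]]].
  by apply: prime_intersection => // a I maxI; apply: QC maxI QF; case: nF.
split; first by apply: nfilter_bigcap => G /FsP[[]].
by apply: QI => // G /FsP[].
Qed.

Local Close Scope order_scope.

Theorem mainTheorem2 (d : Order.disp_t) (L : deMorganLatticeType d) (n : nat)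
    (hn : 1 <= n) :
  [/\ forall F : set L,
        nfilter n F <-> nonempty_intersection_of (prime_nfilter n) F,
      forall F : set L,
        nfilter n F /\ complete_upset F <->
        nonempty_intersection_of
          (fun G => prime_nfilter n G /\ complete_upset G) F,
      forall F : set L,
        nfilter n F /\ consistent_upset F <->
        nonempty_intersection_of
          (fun G => prime_nfilter n G /\ consistent_upset G) F,
      forall F : set L,
        nfilter n F /\ classical_upset F <->
        nonempty_intersection_of
          (fun G => prime_nfilter n G /\ classical_upset G) F
    & forall F : set L,
        nfilter n F /\ kalman_upset F <->
        nonempty_intersection_of
          (fun G => prime_nfilter n G /\ kalman_upset G) F].
Proof.
split; [|apply: nfilter_intersectionP..].
- move=> F; split=> [nF|[Fs [_ FsP ->]]]; last first.
    by apply: nfilter_bigcap => G /FsP[].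
  (* The case without extra condition takes [Q] to be trivial; [I] is here the proof of [True], not
     an ideal. *)
  have [Fs [Fs0 FsP ->]] := @prime_intersection _ _ n (fun=> True) F nF I
    (fun _ _ _ => I).
  by exists Fs; split=> // G /FsP[].
- by move=> F I a; apply: complete_compl_avoiding.
- exact: complete_bigcap.
- by move=> F I a _; apply: consistent_compl_avoiding.
- exact: consistent_bigcap.
- move=> F I a upF maxI [cF kF]; split.
    exact: complete_compl_avoiding maxI cF.
  exact: consistent_compl_avoiding maxI kF.
- move=> Fs Fs0 FsP; split.
    by apply: complete_bigcap => // G /FsP[].
  by apply: consistent_bigcap => // G /FsP[].
- by move=> F I a _; apply: kalman_compl_avoiding.
- by move=> Fs _; apply: kalman_bigcap.
Qed.
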